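(* Let $(\varepsilon_k)_{k\ge0}$ be independent and identically distributed random variables with $\mathbb{P}(\varepsilon_k=1)=\mathbb{P}(\varepsilon_k=-1)=\tfrac12$, and let $F(z)=\sum_{k=0}^\infty\varepsilon_kz^k$ for $z\in\mathbb{D}$. Then almost surely $F$ has no double zeros in $\mathbb{D}$, i.e. almost surely there is no $z\in\mathbb{D}$ with $F(z)=F'(z)=0$. In particular, almost surely, for every compact set $K\subset\mathbb{D}$, the series $F$ is $\kappa$-good with respect to $K$ for all sufficiently small $\kappa>0$.
   Context: $\mathbb{D}=\{z\in\mathbb{C}:|z|<1\}$. A Littlewood series is a power series $P(z)=\sum_{k\ge0}a_kz^k$ with all $a_k\in\{-1,+1\}$; it is analytic on $\mathbb{D}$. For a compact set $K\subset\mathbb{D}$ and $\kappa>0$, a Littlewood series $P$ is $\kappa$-good with respect to $K$ if $|P'(\alpha)|\ge\kappa$ for every $\alpha\in K$ with $P(\alpha)=0$. *)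

(* Defs.v *)
From HB Require Import structures.
From mathcomp Require Import all_boot all_order all_algebra.
From mathcomp Require Import finmap.
From mathcomp Require Import all_classical all_reals all_analysis.
From mathcomp Require Import complex.

Set Implicit Arguments.
Unset Strict Implicit.
Unset Printing Implicit Defensive.

Import Order.TTheory GRing.Theory Num.Theory.
Import numFieldNormedType.Exports.

Local Open Scope classical_set_scope.
Local Open Scope ring_scope.

(* [R[i]] carries no topology by itself; going through [numFieldType] gives it
   the topology of its complex modulus, so that [lim], [compact] and the
   derivative [f^`()] below are the usual complex notions. *)
Definition Cplx (R : realType) : numFieldType := R[i].

Definition unit_disc (R : realType) : set (Cplx R) := [set z | `|z| < 1].

Definition power_series (R : realType) (a : nat -> R) : Cplx R -> Cplx R :=
  fun z => lim (series (fun k => ((a k)%:C%C : Cplx R) * z ^+ k) @ \oo).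

Definition littlewood (R : realType) (a : nat -> R) : Prop :=
  forall k, a k = 1 \/ a k = -1.

Definition kappa_good (R : realType) (kappa : R) (K : set (Cplx R))
    (a : nat -> R) : Prop :=
  littlewood a /\
  forall alpha : Cplx R, K alpha -> power_series a alpha = 0 ->
    (kappa%:C%C : Cplx R) <= `|(power_series a)^`()%classic alpha|.

Definition mutually_independent (d : measure_display) (T : measurableType d)
    (R : realType) (P : probability T R) (X : nat -> {RV P >-> R}) : Prop :=
  forall (J : {fset nat}) (B : nat -> set R),
    (forall k, measurable (B k)) ->
    P (\bigcap_(k in [set` J]) (X k @^-1` B k)) =
    (\prod_(k <- J) P (X k @^-1` B k))%E.

(* Main.v *)
(** Let F be a fixed Littlewood series and r < 1.  For all large n, changing the
    sign of the n-th coefficient (and of no coefficient in a bounded window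
    after it, but possibly of later ones) never produces a double zero in
    |z| <= r.  Indeed, if P = F + z^n U with |U| bounded above and below has a
    double zero at z, then F(z) = - z^n U(z) is exponentially small while
    F'(z) / F(z) is n / z + O(1); near a zero w of F of order m the latter is
    m / (z - w) + O(1), so |z - w| is at least of order 1/n and |F(z)| at least
    of order n^(-m).

    On the other hand, the set of sign sequences having a double zero in
    |z| <= r lies in the closed set cut out by its initial segments.  Flipping
    the n-th coin asymptotically preserves any such set, so a set of positive
    probability would contain, for infinitely many n, both a sequence and its
    flip at n.  Hence the probability is zero. *)

Require Import Defs.
From HB Require Import structures.
From mathcomp Require Import all_boot all_order all_algebra.
From mathcomp Require Import finmap.
From mathcomp Require Import all_classical all_reals all_analysis.
From mathcomp Require Import complex.
From mathcomp Require Import ring lra zify.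

Import Order.TTheory GRing.Theory Num.Theory.
Import numFieldNormedType.Exports.

Local Open Scope classical_set_scope.
Local Open Scope ring_scope.

Set Implicit Arguments.
Unset Strict Implicit.

(** * Bounded power series on the unit disc *)

Section Modulus.
Context {R : realType}.
Implicit Types z w : Cplx R.

(** The norm of [Cplx R] takes values in [Cplx R] itself, on the real axis; its real part lets
    estimates run in the ordered field [R]. *)
Definition modulus z : R := complex.Re `|z|.

Lemma normE z : `|z| = (modulus z)%:C%C.
Proof. by rewrite /modulus complex.RRe_real ?normr_real. Qed.

Lemma lt_modulus z (x : R) : (`|z| < x%:C%C) = (modulus z < x).
Proof. by rewrite normE ltcR. Qed.

Lemma modulus_ge0 z : 0 <= modulus z.
Proof. by have := normr_ge0 z; rewrite normE ler0c. Qed.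

Lemma modulus0 : modulus 0 = 0.
Proof. by rewrite /modulus normr0. Qed.

Lemma modulus1 : modulus 1 = 1.
Proof. by rewrite /modulus normr1. Qed.

Lemma modulus_eq0 z : (modulus z == 0) = (z == 0).
Proof. by rewrite -(normr_eq0 z) normE eq_complex /= eqxx andbT. Qed.

Lemma modulus_gt0 z : (0 < modulus z) = (z != 0).
Proof. by rewrite lt_def modulus_ge0 andbT modulus_eq0. Qed.

Lemma modulusM z w : modulus (z * w) = modulus z * modulus w.
Proof. by apply: complexI; rewrite rmorphM /= -!normE normrM. Qed.

Lemma modulusX z n : modulus (z ^+ n) = modulus z ^+ n.
Proof. by elim: n => [|n IH]; rewrite ?expr0 ?modulus1// !exprS modulusM IH. Qed.

Lemma modulusN z : modulus (- z) = modulus z.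
Proof. by rewrite /modulus normrN. Qed.

Lemma modulusD z w : modulus (z + w) <= modulus z + modulus w.
Proof. by rewrite -lecR rmorphD /= -!normE ler_normD. Qed.

Lemma modulusB z w : modulus (z - w) <= modulus z + modulus w.
Proof. by rewrite -(modulusN w) modulusD. Qed.

Lemma modulus_distC z w : modulus (z - w) = modulus (w - z).
Proof. by rewrite -modulusN opprB. Qed.

Lemma modulusB_ge z w : modulus z - modulus w <= modulus (z - w).
Proof. by rewrite lerBlDr; have := modulusD (z - w) w; rewrite subrK. Qed.

Lemma modulus_real (x : R) : modulus (x%:C%C) = `|x|.
Proof. by rewrite /modulus normc_def /= expr0n /= addr0 sqrtr_sqr. Qed.

Lemma modulus_nat n : modulus n%:R = n%:R.
Proof. by rewrite -(rmorph_nat (real_complex R)) modulus_real normr_nat. Qed.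

Lemma modulus_Re z : `|complex.Re z| <= modulus z.
Proof.
by rewrite /modulus normc_def /= -sqrtr_sqr ler_wsqrtr // lerDl sqr_ge0.
Qed.

Lemma modulus_Im z : `|complex.Im z| <= modulus z.
Proof.
by rewrite /modulus normc_def /= -sqrtr_sqr ler_wsqrtr // lerDr sqr_ge0.
Qed.

Lemma modulus_le_ReIm z : modulus z <= `|complex.Re z| + `|complex.Im z|.
Proof.
have e0 : 0 <= `|complex.Re z| + `|complex.Im z| by rewrite addr_ge0.
rewrite /modulus normc_def /= -(ger0_norm e0) -(sqrtr_sqr (_ + _)) ler_wsqrtr //.
by rewrite sqrrD !real_normK ?num_real// -addrA lerD2l lerDr mulrn_wge0// mulr_ge0.
Qed.

Lemma ReB z w : complex.Re (z - w) = complex.Re z - complex.Re w.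
Proof. by case: z w => [? ?] []. Qed.

Lemma ImB z w : complex.Im (z - w) = complex.Im z - complex.Im w.
Proof. by case: z w => [? ?] []. Qed.

Lemma nbhs_CplxP z (A : set (Cplx R)) :
  nbhs z A <-> exists2 e : R, 0 < e & forall y, modulus (z - y) < e -> A y.
Proof.
split=> [/nbhs_ballP[e /= e0 eA]|[e e0 eA]]; last apply/nbhs_ballP.
  have eR : e = (complex.Re e)%:C%C by rewrite complex.RRe_real// ger0_real// ltW.
  exists (complex.Re e); first by rewrite -ltcR -eR.
  by move=> y; rewrite -lt_modulus -eR => /eA.
exists (e%:C%C : Cplx R); first by rewrite /= ltcR.
by move=> y; rewrite /ball/= lt_modulus; exact: eA.
Qed.

Lemma cvg_CplxP {T} (F : set_system T) {FF : Filter F} (f : T -> Cplx R) z :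
  f @ F --> z <-> (fun t => modulus (z - f t)) @ F --> (0 : R).
Proof.
split.
  move=> fz; apply/cvgrPdist_lt => e e0.
  have /fz : nbhs z [set y | modulus (z - y) < e] by apply/nbhs_CplxP; exists e.
  apply: (@filterS _ F) => t /=.
  by rewrite sub0r normrN ger0_norm ?modulus_ge0.
move/cvgrPdist_lt => fz A /nbhs_CplxP[e e0 eA].
apply: (@filterS _ F) (fz e e0) => t /=.
by rewrite sub0r normrN ger0_norm ?modulus_ge0// => /eA.
Qed.

Lemma cvg_Cplx {T} (F : set_system T) {FF : Filter F} (f : T -> Cplx R) z :
  (fun t => complex.Re (f t)) @ F --> complex.Re z ->
  (fun t => complex.Im (f t)) @ F --> complex.Im z -> f @ F --> z.
Proof.
move=> /cvgrPdist_lt fr /cvgrPdist_lt fi.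
apply/cvg_CplxP/cvgrPdist_lt => e e0.
have e20 : 0 < e / 2 by rewrite divr_gt0.
near=> t.
rewrite sub0r normrN ger0_norm ?modulus_ge0//.
apply: le_lt_trans (modulus_le_ReIm _) _.
rewrite [e]splitr ltrD//.
  have : `|complex.Re z - complex.Re (f t)| < e / 2 by near: t; exact: fr.
  by rewrite ReB.
have : `|complex.Im z - complex.Im (f t)| < e / 2 by near: t; exact: fi.
by rewrite ImB.
Unshelve. all: by end_near.
Qed.

Lemma compact_closed_disc (r : R) : compact [set z | modulus z <= r].
Proof.
pose sq := (`[- r, r]%classic : set R) `*` (`[- r, r]%classic : set R).
pose f := fun p : R * R => (Complex p.1 p.2 : Cplx R).
have fc : continuous f.
  move=> p; apply: cvg_Cplx => /=; [exact: cvg_fst|exact: cvg_snd].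
have cK : compact (f @` sq).
  apply: continuous_compact; first exact: continuous_subspaceT.
  by apply: compact_setX; exact: segment_compact.
apply: subclosed_compact cK _ => [|z /= zr].
  move=> z zcl; rewrite /= leNgt; apply/negP => rz.
  have : nbhs z [set y | modulus (z - y) < modulus z - r].
    by apply/nbhs_CplxP; exists (modulus z - r); rewrite ?subr_gt0.
  move=> /zcl [y [/= yr zy]].
  have := modulusB_ge z y.
  by apply/negP; rewrite -ltNge; apply: lt_le_trans zy _; rewrite lerB.
exists (complex.Re z, complex.Im z); last by case: z zr.
by split=> /=; rewrite in_itv /= -ler_norml;
  [apply: le_trans (modulus_Re z) zr|apply: le_trans (modulus_Im z) zr].
Qed.

End Modulus.

(* Locked, so that arithmetic tactics do not unfold limits to compare atoms. *)
HB.lock Definition psum (R : realType) (a : nat -> Cplx R) (z : Cplx R)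
  : Cplx R := lim (series (fun k => a k * z ^+ k) @ \oo).

(** * Power sums with bounded coefficients, divided differences and derivatives *)

Section PowerSums.
Context {R : realType}.
Implicit Types (a b : nat -> Cplx R) (z w : Cplx R).

Definition bounded_by (A : R) a := forall k, modulus (a k) <= A.

Lemma geometric_sum_le (r : R) n : 0 <= r < 1 ->
  \sum_(0 <= k < n) r ^+ k <= (1 - r)^-1.
Proof.
case/andP => r0 r1; rewrite -[leRHS]mul1r ler_pdivlMr ?subr_gt0//.
suff -> : (\sum_(0 <= k < n) r ^+ k) * (1 - r) = 1 - r ^+ n.
  by rewrite lerBlDr lerDl exprn_ge0.
elim: n => [|n IH]; first by rewrite big_geq// mul0r subrr.
by rewrite big_nat_recr//= mulrDl IH exprS; ring.
Qed.

Lemma bounded_by_ge0 A a : bounded_by A a -> 0 <= A.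
Proof. by move=> /(_ 0%N); apply: le_trans; exact: modulus_ge0. Qed.

Lemma modulus_term_le A a z k : bounded_by A a ->
  modulus (a k * z ^+ k) <= A * modulus z ^+ k.
Proof.
by move=> aA; rewrite modulusM modulusX ler_wpM2r// exprn_ge0// modulus_ge0.
Qed.

Lemma real_series_cvg (u : nat -> R) (A r : R) : 0 <= r < 1 ->
  (forall k, `|u k| <= A * r ^+ k) -> cvgn (series u).
Proof.
case/andP => r0 r1 uA; apply: normed_cvg.
apply: (series_le_cvg (v_ := geometric A r)) => [n|n|n|].
- exact: normr_ge0.
- by apply: le_trans (uA n); exact: normr_ge0.
- exact: uA.
- by apply: is_cvg_geometric_series; rewrite ger0_norm.
Qed.

Lemma Re_sum (u : nat -> Cplx R) n :
  complex.Re (\sum_(0 <= k < n) u k) = \sum_(0 <= k < n) complex.Re (u k).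
Proof.
elim: n => [|n IH]; first by rewrite !big_geq.
by rewrite !big_nat_recr//= -IH; case: (\sum_(0 <= k < n) _) (u n) => ? ? [].
Qed.

Lemma Im_sum (u : nat -> Cplx R) n :
  complex.Im (\sum_(0 <= k < n) u k) = \sum_(0 <= k < n) complex.Im (u k).
Proof.
elim: n => [|n IH]; first by rewrite !big_geq.
by rewrite !big_nat_recr//= -IH; case: (\sum_(0 <= k < n) _) (u n) => ? ? [].
Qed.

Lemma psum_eq a z l :
  series (fun k => a k * z ^+ k) @ \oo --> l -> psum a z = l.
Proof. by rewrite psum.unlock => /cvg_lim; apply; exact: norm_hausdorff. Qed.

Lemma psum_cvg A a z : bounded_by A a -> modulus z < 1 ->
  series (fun k => a k * z ^+ k) @ \oo --> psum a z.
Proof.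
move=> aA z1; set u := fun k => a k * z ^+ k.
have z01 : 0 <= modulus z < 1 by rewrite modulus_ge0.
have cr : cvgn (series (fun k => complex.Re (u k))).
  apply: (real_series_cvg z01) => k.
  by apply: le_trans (modulus_Re _) _; exact: modulus_term_le aA.
have ci : cvgn (series (fun k => complex.Im (u k))).
  apply: (real_series_cvg z01) => k.
  by apply: le_trans (modulus_Im _) _; exact: modulus_term_le aA.
pose l : Cplx R := Complex (limn (series (fun k => complex.Re (u k))))
                           (limn (series (fun k => complex.Im (u k)))).
have ul : series u @ \oo --> l.
  apply: cvg_Cplx => /=.
    by rewrite (_ : (fun t => _) = series (fun k => complex.Re (u k)))//;
       apply/funext => n; exact: Re_sum.
  by rewrite (_ : (fun t => _) = series (fun k => complex.Im (u k)))//;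
     apply/funext => n; exact: Im_sum.
by rewrite (psum_eq ul).
Qed.

Lemma modulus_sum (u : nat -> Cplx R) n :
  modulus (\sum_(0 <= k < n) u k) <= \sum_(0 <= k < n) modulus (u k).
Proof.
elim: n => [|n IH]; first by rewrite !big_geq// modulus0.
by rewrite !big_nat_recr//= (le_trans (modulusD _ _))// lerD2r.
Qed.

Lemma modulus_psum A a z : bounded_by A a -> modulus z < 1 ->
  modulus (psum a z) <= A / (1 - modulus z).
Proof.
move=> aA z1; apply/ler_addgt0Pr => e e0.
have /cvg_CplxP/cvgrPdist_lt/(_ e e0) [n _ /(_ n)] := psum_cvg aA z1.
rewrite /= leqnn sub0r normrN ger0_norm ?modulus_ge0// => /(_ isT) sn.
have A0 := bounded_by_ge0 aA.
set s := series _ n in sn.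
have -> : psum a z = s + (psum a z - s) by rewrite addrC subrK.
apply: le_trans (modulusD _ _) _; apply: lerD; last exact: ltW.
apply: le_trans (modulus_sum _ _) _.
apply: (@le_trans _ _ (\sum_(0 <= k < n) A * modulus z ^+ k)).
  by apply: ler_sum => k _; exact: modulus_term_le.
rewrite -mulr_sumr ler_wpM2l//; apply: geometric_sum_le.
by rewrite modulus_ge0.
Qed.

Lemma psum_linear A B a b c z : bounded_by A a -> bounded_by B b ->
  modulus z < 1 ->
  psum (fun k => a k + c * b k) z = psum a z + c * psum b z.
Proof.
move=> aA bB z1; apply: psum_eq.
rewrite (_ : series _ = (fun n => series (fun k => a k * z ^+ k) n +
                       c * series (fun k => b k * z ^+ k) n)).
  by apply: cvgD; [exact: psum_cvg aA _|apply: cvgMr; exact: psum_cvg bB _].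
apply/funext => n; rewrite /series/= mulr_sumr -big_split/=.
by apply: eq_bigr => k _; rewrite mulrDl mulrA.
Qed.

Lemma psum_recl A a z : bounded_by A a -> modulus z < 1 ->
  psum a z = a 0%N + z * psum (fun k => a k.+1) z.
Proof.
move=> aA z1; apply: psum_eq.
rewrite -cvg_shiftS.
rewrite [X in X @ _ --> _](_ : _ = (fun n => a 0%N +
    z * series (fun k => a k.+1 * z ^+ k) n)).
  apply: cvgD; first exact: cvg_cst.
  by apply: cvgMr; apply: (psum_cvg (A := A)) => // k.
apply/funext => n; rewrite /series/= mulr_sumr big_nat_recl//= expr0 mulr1.
by congr (_ + _); apply: eq_bigr => k _; rewrite exprS mulrCA.
Qed.

(* Coefficients of the divided difference (F(z) - F(w)) / (z - w). *)
Definition divdiff w a : nat -> Cplx R :=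
  fun k => psum (fun j => a (k.+1 + j)%N) w.

Lemma bounded_divdiff A a w : bounded_by A a -> modulus w < 1 ->
  bounded_by (A / (1 - modulus w)) (divdiff w a).
Proof. by move=> aA w1 k; apply: modulus_psum => // j. Qed.

Lemma divdiff_rec A a w k : bounded_by A a -> modulus w < 1 ->
  divdiff w a k = a k.+1 + w * divdiff w a k.+1.
Proof.
move=> aA w1; rewrite /divdiff (psum_recl (A := A)) => [||//]; last by move=> j.
rewrite addn0.
have -> : (fun j => a (k.+1 + j.+1)%N) = (fun j => a (k.+2 + j)%N) by
  apply/funext => j; rewrite addnS.
by [].
Qed.

(** With b = [divdiff w a], the recurrence a_{k+1} = b_k - w b_{k+1} writes the shifted series at z
    as a combination of two series in b, and the factor z - w comes out without rearranging a double
    sum. *)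
Lemma psum_divdiff A a w z : bounded_by A a -> modulus w < 1 ->
  modulus z < 1 -> psum a z = psum a w + (z - w) * psum (divdiff w a) z.
Proof.
move=> aA w1 z1; set b := divdiff w a.
have bB : bounded_by (A / (1 - modulus w)) b by exact: bounded_divdiff.
have bS : bounded_by (A / (1 - modulus w)) (fun k => b k.+1) by move=> k.
rewrite (psum_recl aA z1).
have -> : (fun k => a k.+1) = (fun k => b k + (- w) * b k.+1).
  by apply/funext => k; rewrite [b k](divdiff_rec _ aA w1) -/b; ring.
rewrite (psum_linear _ bB bS z1) (psum_recl aA w1).
have -> : psum (fun k => a k.+1) w = b 0%N.
  by congr psum; apply/funext => j; rewrite add1n.
by rewrite (psum_recl bB z1); ring.
Qed.

Lemma psum_lipschitz A a w z (r : R) : bounded_by A a -> r < 1 ->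
  modulus w <= r -> modulus z <= r ->
  modulus (psum a z - psum a w) <= modulus (z - w) * (A / (1 - r) ^+ 2).
Proof.
move=> aA r1 wr zr.
have w1 := le_lt_trans wr r1; have z1 := le_lt_trans zr r1.
have A0 := bounded_by_ge0 aA.
rewrite (psum_divdiff aA w1 z1) addrC addKr modulusM ler_wpM2l ?modulus_ge0//.
apply: le_trans (modulus_psum (bounded_divdiff aA w1) z1) _.
rewrite -mulrA ler_wpM2l// -invfM lef_pV2 ?posrE ?exprn_gt0 ?mulr_gt0 ?subr_gt0//.
by rewrite expr2 ler_pM ?subr_ge0 ?(ltW r1)// lerB.
Qed.

Lemma psum_continuous A a z : bounded_by A a -> modulus z < 1 ->
  {for z, continuous (psum a)}.
Proof.
move=> aA z1.
apply/(@cvg_CplxP _ _ (nbhs z) (nbhs_filter z))/cvgrPdist_lt => e e0.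
pose r := (1 + modulus z) / 2.
have r1 : r < 1 by rewrite /r; lra.
have A0 := bounded_by_ge0 aA.
pose M := A / (1 - r) ^+ 2.
have M0 : 0 <= M by rewrite divr_ge0// exprn_ge0// subr_ge0 ltW.
have d0 : 0 < Num.min ((1 - modulus z) / 2) (e / (M + 1)).
  by rewrite lt_min !divr_gt0// ?subr_gt0// ltr_pwDr.
apply/nbhs_CplxP; exists (Num.min ((1 - modulus z) / 2) (e / (M + 1))) => //.
move=> y; rewrite lt_min => /andP[zy1 zy2].
rewrite sub0r normrN ger0_norm ?modulus_ge0//.
have zr : modulus z <= r by rewrite /r; lra.
have yr : modulus y <= r.
  by have := modulusB_ge y z; rewrite modulus_distC /r; lra.
apply: le_lt_trans (psum_lipschitz aA r1 yr zr) _; rewrite -/M.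
move: zy2; rewrite ltr_pdivlMr ?ltr_pwDr//; apply: le_lt_trans.
by rewrite ler_wpM2l ?modulus_ge0// lerDl.
Qed.

(** By [psum_divdiff] the difference quotient at z is the sum of [divdiff z a] at h + z, which is
    continuous. Hence [psum (divdiff z a) z] stands for F'(z) from here on. *)
Lemma is_derive_psum A a z : bounded_by A a -> modulus z < 1 ->
  is_derive z 1 (psum a) (psum (divdiff z a) z).
Proof.
move=> aA z1.
have quot : (fun h => h^-1 *: (psum a (h *: 1 + z) - psum a z)) @ 0^' -->
    psum (divdiff z a) z.
  have := psum_continuous (bounded_divdiff aA z1) z1.
  move=> /(@cvg_CplxP _ _ (nbhs z) (nbhs_filter z))/cvgrPdist_lt c.
  apply/cvg_CplxP/cvgrPdist_lt => e e0.
  have [d d0 dc] := (nbhs_CplxP _ _).1 (c e e0).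
  have m0 : 0 < Num.min d (1 - modulus z) by rewrite lt_min d0 subr_gt0.
  apply/nbhs_CplxP; exists (Num.min d (1 - modulus z)) => // h.
  rewrite sub0r modulusN lt_min => /andP[hd hz] h0.
  have hz1 : modulus (h + z) < 1 by have := modulusD h z; lra.
  have -> : h^-1 *: (psum a (h *: 1 + z) - psum a z) =
      psum (divdiff z a) (h + z).
    apply: (mulfI h0); rewrite /GRing.scale/= mulr1 (mulrA h) divff// mul1r.
    rewrite (psum_divdiff aA z1 hz1).
    by move: (psum a z) (psum _ _) => p q; ring.
  by apply: dc; rewrite opprD addrCA subrr addr0 modulusN.
by apply: DeriveDef; [apply: cvgP quot|apply: cvg_lim quot; exact: norm_hausdorff].
Qed.

End PowerSums.

(** * Order of vanishing at a point of the disc *)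

Section ZeroOrder.
Context {R : realType}.
Implicit Types (a b : nat -> Cplx R) (z w : Cplx R).

(** The value [psum (divdiffs w m a) w] is the m-th Taylor coefficient of the series at w. *)
Definition divdiffs w m a := iter m (divdiff w) a.

Lemma bounded_divdiffs A a w m : bounded_by A a -> modulus w < 1 ->
  bounded_by (A / (1 - modulus w) ^+ m) (divdiffs w m a).
Proof.
move=> aA w1; elim: m => [|m IH]; first by rewrite expr0 divr1.
by rewrite exprSr invfM mulrA; exact: bounded_divdiff.
Qed.

Lemma psum_divdiffs A a w z m : bounded_by A a -> modulus w < 1 ->
  modulus z < 1 -> (forall j, (j < m)%N -> psum (divdiffs w j a) w = 0) ->
  psum a z = (z - w) ^+ m * psum (divdiffs w m a) z.
Proof.
move=> aA w1 z1; elim: m => [|m IH] am; first by rewrite expr0 mul1r.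
rewrite IH => [|j jm]; last by rewrite am// ltnW.
by rewrite (psum_divdiff (bounded_divdiffs m aA w1) w1 z1) am// add0r mulrA exprSr.
Qed.

Definition flat a w := forall m, psum (divdiffs w m a) w = 0.

(** Dividing n times by z - w leaves coefficients bounded by A / (1 - |w|)^n, so |F(z)| is at most a
    constant times (|z - w| / (1 - |w|))^n for every n. *)
Lemma flat_ball A a w z : bounded_by A a -> modulus w < 1 -> modulus z < 1 ->
  flat a w -> modulus (z - w) < 1 - modulus w -> psum a z = 0.
Proof.
move=> aA w1 z1 aw zw; apply/eqP; rewrite -modulus_eq0 eq_le modulus_ge0 andbT.
apply/ler_addgt0Pr => e e0; rewrite add0r.
pose q := modulus (z - w) / (1 - modulus w).
have q1 : `|q| < 1.
  by rewrite ger0_norm ?divr_ge0 ?modulus_ge0 ?subr_ge0 1?ltW//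
    ltr_pdivrMr ?subr_gt0// mul1r.
have /cvgrPdist_lt/(_ e e0) [n _ /(_ n)] :=
  cvg_geometric (A / (1 - modulus z)) q1.
rewrite /= leqnn sub0r normrN => /(_ isT) qe.
rewrite (psum_divdiffs aA w1 z1 (fun j (_ : (j < n)%N) => aw j)).
apply/ltW/(le_lt_trans _ qe)/(le_trans _ (ler_norm _)).
rewrite modulusM modulusX /geometric/= /q expr_div_n.
apply: (@le_trans _ _ (modulus (z - w) ^+ n *
   (A / (1 - modulus w) ^+ n / (1 - modulus z)))).
  rewrite ler_wpM2l ?exprn_ge0 ?modulus_ge0//.
  exact: modulus_psum (bounded_divdiffs n aA w1) z1.
by rewrite le_eqVlt; apply/orP; left; apply/eqP; ring.
Qed.

Lemma finite_order a w : ~ flat a w -> exists m,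
  psum (divdiffs w m a) w != 0 /\
  forall j, (j < m)%N -> psum (divdiffs w j a) w = 0.
Proof.
move=> /existsNP[k /eqP ak].
have ex : exists m, psum (divdiffs w m a) w != 0 by exists k.
case: (ex_minnP ex) => m am min; exists m; split=> // j jm.
by apply/eqP/negPn/negP => /min; rewrite leqNgt jm.
Qed.

Lemma psum_neq0_near A a w : bounded_by A a -> modulus w < 1 ->
  psum a w != 0 -> exists2 d : R, 0 < d &
    forall z, modulus (w - z) < d -> modulus (psum a w) / 2 <= modulus (psum a z).
Proof.
move=> aA w1 aw.
have e0 : 0 < modulus (psum a w) / 2 by rewrite divr_gt0// modulus_gt0.
have := psum_continuous aA w1.
move=> /(@cvg_CplxP _ _ (nbhs w) (nbhs_filter w))/cvgrPdist_lt/(_ _ e0).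
move=> /nbhs_CplxP[d d0 dw]; exists d => // z /dw.
rewrite sub0r normrN ger0_norm ?modulus_ge0// => h.
by have := modulusB_ge (psum a w) (psum a w - psum a z); rewrite subKr; lra.
Qed.

(** At a finite order m, F(w + t) = t^m b(w + t) with b nonzero near w, so F would not vanish at w +
    t for small real t > 0. *)
Lemma flat_of_zero_ball A a w d : bounded_by A a -> modulus w < 1 -> 0 < d ->
  (forall z, modulus (z - w) < d -> modulus z < 1 -> psum a z = 0) ->
  flat a w.
Proof.
move=> aA w1 d0 az; apply: contrapT => /finite_order[m [bw am]].
have [d' d'0 bz] := psum_neq0_near (bounded_divdiffs m aA w1) w1 bw.
pose t := Num.min d (Num.min d' (1 - modulus w)) / 2.
have t0 : 0 < t by rewrite divr_gt0// !lt_min d0 d'0 subr_gt0.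
have t2 : t < Num.min d (Num.min d' (1 - modulus w)) by rewrite /t in t0 *; lra.
move: t2; rewrite !lt_min => /and3P[td td' tw].
pose z : Cplx R := w + t%:C%C.
have mt : modulus (t%:C%C : Cplx R) = t by rewrite modulus_real gtr0_norm.
have zw : z - w = t%:C%C by rewrite /z addrC addKr.
have z1 : modulus z < 1 by have := modulusD w t%:C%C; rewrite mt -/z; lra.
have : psum a z = 0 by apply: az => //; rewrite zw mt.
move/eqP; rewrite (psum_divdiffs aA w1 z1 am) zw mulf_eq0 expf_eq0.
rewrite -modulus_eq0 mt (gt_eqF t0) andbF/= -modulus_eq0.
have := bz z; rewrite -opprB modulusN zw mt => /(_ td').
by move: bw; rewrite -modulus_gt0; case: eqP => // -> ? ?; lra.
Qed.

Lemma psum0 A a : bounded_by A a -> psum a 0 = a 0%N.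
Proof. by move=> aA; rewrite (psum_recl aA) ?mul0r ?addr0// modulus0. Qed.

(* Flatness at c propagates to every point at distance less than 1 - |c|, hence
   in finitely many steps along the segment from w to 0. *)
Lemma not_flat A a w : bounded_by A a -> a 0%N != 0 -> modulus w < 1 ->
  ~ flat a w.
Proof.
move=> aA a0 w1 aw.
(* M is the number of steps from w to 0, large enough for the step length |w| / M to be less than 1
   - |w|. *)
pose M := (Num.truncn (modulus w / (1 - modulus w))).+1.
have M0 : 0 < M%:R :> R by rewrite ltr0n.
have wM : modulus w / M%:R < 1 - modulus w.
  rewrite ltr_pdivrMr// mulrC -ltr_pdivrMr ?subr_gt0//.
  by rewrite truncnS_gt.
pose c j : Cplx R := w * (((M - j)%N%:R / M%:R : R)%:C%C).
have mc j : modulus (c j) <= modulus w.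
  rewrite /c modulusM modulus_real ger0_norm ?divr_ge0//.
  rewrite ler_piMr ?modulus_ge0// ler_pdivrMr// mul1r ler_nat.
  exact: leq_subr.
suff : flat a (c M).
  move=> /(_ 0%N); rewrite /c subnn mul0r mulr0 (psum0 aA).
  by move/eqP; rewrite (negPf a0).
suff : forall j, (j <= M)%N -> flat a (c j) by apply.
elim => [_|j IH jM]; first by rewrite /c subn0 divff ?gt_eqF// mulr1.
have step : modulus (c j.+1 - c j) = modulus w / M%:R.
  have -> : c j.+1 - c j = w * (- (M%:R^-1 : R)%:C%C).
    rewrite -mulrBr -rmorphB -rmorphN /=; congr (_ * (_)%:C%C).
    by rewrite -mulrBl subnS -subn1 natrB ?subn_gt0// addrC addKr mulN1r.
  by rewrite modulusM modulusN modulus_real ger0_norm ?invr_ge0.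
have cj1 := le_lt_trans (mc j) w1.
(* A point this close to [c j.+1] is within 1 - |w| <= 1 - |c j| of [c j], where flatness is already
   known. *)
apply: (flat_of_zero_ball (d := 1 - modulus w - modulus w / M%:R) aA).
- exact: le_lt_trans (mc _) w1.
- by rewrite subr_gt0.
move=> z zd z1; apply: (flat_ball aA cj1 z1); first exact: IH (ltnW jM).
rewrite -(subrK (c j.+1) z) -addrA.
apply: le_lt_trans (modulusD _ _) _; rewrite step.
by have := mc j; lra.
Qed.

(** The order m is finite because the nonzero constant term excludes flatness; m = 0 covers the
    points w that are not zeros. *)
Lemma zero_order A a w : bounded_by A a -> a 0%N != 0 -> modulus w < 1 ->
  exists m b B, [/\ bounded_by B b, psum b w != 0 &
    forall z, modulus z < 1 -> psum a z = (z - w) ^+ m * psum b z].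
Proof.
move=> aA a0 w1; have [m [bw am]] := finite_order (not_flat aA a0 w1).
exists m, (divdiffs w m a), (A / (1 - modulus w) ^+ m); split=> //.
  exact: bounded_divdiffs.
by move=> z z1; exact: psum_divdiffs aA w1 z1 am.
Qed.

End ZeroOrder.

(** * Changing one sign *)

Section Flip.
Context {R : realType}.
Implicit Types (a b c : nat -> Cplx R) (z w : Cplx R) (s : nat -> bool).

Lemma bernoulli_le (x : R) n : 0 <= x <= 1 -> 1 - n%:R * x <= (1 - x) ^+ n.
Proof.
case/andP => x0 x1; elim: n => [|n IH]; first by rewrite mul0r subr0 expr0.
rewrite exprSr; apply: (@le_trans _ _ ((1 - n%:R * x) * (1 - x))); last first.
  by rewrite ler_wpM2r ?subr_ge0.
rewrite -natr1 -subr_ge0.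
have -> : (1 - n%:R * x) * (1 - x) - (1 - (n%:R + 1) * x) = n%:R * (x * x) by ring.
by rewrite mulr_ge0 ?mulr_ge0.
Qed.

(** Each of the n terms 1, q, ..., q^(n-1) of the geometric sum is at least q^n. *)
Lemma natM_expr_le (q : R) n : 0 <= q < 1 -> n%:R * q ^+ n <= (1 - q)^-1.
Proof.
move=> /andP[q0 q1]; apply: le_trans (geometric_sum_le n _); last by rewrite q0.
rewrite mulr_natl -[n in _ *+ n]subn0 -sumr_const_nat.
by rewrite big_nat [leRHS]big_nat; apply: ler_sum => k /andP[_ kn];
   apply: ler_wiXn2l; rewrite ?(ltW q1) ?(ltnW kn).
Qed.

Lemma poly_geometric_cvg0 (r M : R) m (e : R) : 0 <= r < 1 -> 0 <= M -> 0 < e ->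
  \forall n \near \oo, (n%:R + M) ^+ m * r ^+ n < e.
Proof.
move=> /andP[r0 r1] M0 e0.
(* q < 1 satisfies r <= q ^ (m + 1), so that (n + M)^m r^n is at most
   ((n + M) q^n)^m q^n, where (n + M) q^n stays bounded *)
pose x := (1 - r) / m.+1%:R.
have x0 : 0 < x by rewrite divr_gt0// subr_gt0.
have x1 : x <= 1 by rewrite ler_pdivrMr// mul1r (@le_trans _ _ 1)// ?gerBl// ler1n.
pose q := 1 - x.
have q0 : 0 <= q by rewrite subr_ge0.
have q1 : q < 1 by rewrite gtrBl.
have rq : r <= q ^+ m.+1.
  apply: le_trans (bernoulli_le m.+1 _); last by rewrite ltW.
  by rewrite mulrC divfK// subKr.
pose K := (1 - q)^-1 + M.
have K0 : 0 <= K by rewrite addr_ge0// invr_ge0 subr_ge0 ltW.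
have nK n : (n%:R + M) * q ^+ n <= K.
  rewrite mulrDl lerD//; first by apply: natM_expr_le; rewrite q0.
  by rewrite ler_piMr// exprn_ile1// ltW.
have q1' : `|q| < 1 by rewrite ger0_norm.
have /cvgrPdist_lt/(_ e e0) := cvg_geometric (K ^+ m) q1'.
apply: (@filterS _ \oo) => n.
rewrite sub0r normrN; apply: le_lt_trans; apply: le_trans (ler_norm _).
have nM : 0 <= n%:R + M by rewrite addr_ge0.
apply: (@le_trans _ _ ((n%:R + M) ^+ m * (q ^+ m.+1) ^+ n)).
  by rewrite ler_wpM2l ?exprn_ge0// lerXn2r// nnegrE exprn_ge0.
have -> : (q ^+ m.+1) ^+ n = (q ^+ n) ^+ m * q ^+ n.
  by rewrite -!exprM -exprD mulSn addnC mulnC.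
rewrite mulrA -exprMn /geometric/= ler_wpM2r ?exprn_ge0//.
by rewrite lerXn2r// ?nnegrE ?mulr_ge0 ?exprn_ge0.
Qed.

(** Serves twice: with f the unperturbed series and w = 0, for a change of coefficients from n on;
    and with f = 0 and w a zero of order n. *)
Lemma derive_psum_factor (f : Cplx R -> Cplx R) (df : Cplx R) A C a c z w n :
  bounded_by A a -> bounded_by C c -> modulus z < 1 -> is_derive z 1 f df ->
  (forall y, modulus y < 1 -> psum a y = f y + (y - w) ^+ n * psum c y) ->
  psum (divdiff z a) z = df + (n%:R * (z - w) ^+ n.-1 * psum c z +
                               (z - w) ^+ n * psum (divdiff z c) z).
Proof.
move=> aA cC z1 fz ace.
have ha := is_derive_psum aA z1; have hc := is_derive_psum cC z1.
have hX := is_deriveX n (is_deriveB (is_derive_id z 1) (is_derive_cst w z 1)).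
have hg := is_deriveD fz (is_deriveM hX hc).
have ag : \near z, psum a z = (f + (id - cst w) ^+ n * psum c) z.
  apply/nbhs_CplxP; exists (1 - modulus z); first by rewrite subr_gt0.
  move=> y zy; rewrite ace.
    by rewrite !fctE.
  by have := modulusB_ge y z; rewrite modulus_distC; lra.
have : 'D_1 (psum a) z = 'D_1 (f + (id - cst w) ^+ n * psum c) z := near_eq_derive _ ag.
rewrite (@derive_val _ _ _ _ _ _ _ ha) (@derive_val _ _ _ _ _ _ _ hg) => ->.
rewrite exprfctE /GRing.scale/= subr0 mulr1.
by congr (_ + _); rewrite [LHS]addrC (mulrC (psum c z)).
Qed.

Definition rademacher s : nat -> R := fun k => if s k then 1 else -1.

Definition signs s : nat -> Cplx R := fun k => (rademacher s k)%:C%C.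

Definition double_zero s z :=
  psum (signs s) z = 0 /\ psum (divdiff z (signs s)) z = 0.

Lemma modulus_signs s k : modulus (signs s k) = 1.
Proof. by rewrite modulus_real /rademacher; case: (s k); rewrite ?normrN normr1. Qed.

Lemma bounded_signs s : bounded_by 1 (signs s).
Proof. by move=> k; rewrite modulus_signs. Qed.

Lemma signs_neq0 s k : signs s k != 0.
Proof. by rewrite -modulus_eq0 modulus_signs oner_eq0. Qed.

(** The constant term has modulus 1, so a zero satisfies 1 <= |z| / (1 - |z|). This turns a bound on
    z F'(z) into one on F'(z). *)
Lemma zero_modulus_ge_half s z : modulus z < 1 -> psum (signs s) z = 0 ->
  2^-1 <= modulus z.
Proof.
move=> z1; rewrite (psum_recl (bounded_signs s) z1) => /eqP.
rewrite addr_eq0 => /eqP/(congr1 modulus).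
rewrite modulus_signs modulusN modulusM => e.
have b : bounded_by 1 (fun k => signs s k.+1) by move=> k; exact: bounded_signs.
have := modulus_psum b z1; rewrite ler_pdivlMr ?subr_gt0// => le1.
have : modulus z * (modulus (psum (fun k => signs s k.+1) z) * (1 - modulus z))
    <= modulus z * 1 by rewrite ler_wpM2l ?modulus_ge0.
by rewrite mulrA -e; lra.
Qed.

Lemma psum_shift A a z n : bounded_by A a -> modulus z < 1 ->
  (forall k, (k < n)%N -> a k = 0) ->
  psum a z = z ^+ n * psum (fun k => a (n + k)%N) z.
Proof.
move=> aA z1; elim: n => [|n IH] a0.
  by rewrite expr0 mul1r; congr psum; apply/funext => k; rewrite add0n.
rewrite IH => [|k kn]; last by rewrite a0// ltnW.
rewrite (psum_recl (A := A)) => [|k|//]; last exact: aA.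
rewrite addn0 a0// add0r mulrA -exprSr; congr (_ * psum _ _).
by apply/funext => k; rewrite addSnnS.
Qed.

(* If P = F + z^n U has a double zero at z, then F and F' can be read off U
   at z; in particular F'/F is close to n/z there. *)
Lemma double_zero_perturb s s' n z : modulus z < 1 ->
  (forall k, (k < n)%N -> s' k = s k) -> double_zero s' z ->
  let c k := signs s' (n + k)%N - signs s (n + k)%N in
  psum (signs s) z = - (z ^+ n * psum c z) /\
  z * psum (divdiff z (signs s)) z =
    n%:R * psum (signs s) z - z ^+ n.+1 * psum (divdiff z c) z.
Proof.
move=> z1 ss' [F0 F1] c.
have cb : bounded_by 2 c.
  move=> k; apply: le_trans (modulusB _ _) _; rewrite !modulus_signs; lra.
have split_psum y : modulus y < 1 ->
    psum (signs s') y = psum (signs s) y + (y - 0) ^+ n * psum c y.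
  move=> y1; pose e k := signs s' k - signs s k.
  have eb : bounded_by 2 e.
    move=> k; apply: le_trans (modulusB _ _) _; rewrite !modulus_signs; lra.
  rewrite subr0 -(psum_shift (a := e) eb y1); last first.
    by move=> k /ss'; rewrite /e /signs /rademacher => ->; rewrite subrr.
  rewrite -[psum e y]mul1r -(psum_linear _ (bounded_signs s) eb y1).
  by congr psum; apply/funext => k; rewrite mul1r /e addrC subrK.
have Fz : psum (signs s) z = - (z ^+ n * psum c z).
  by apply/eqP; rewrite -addr_eq0 -{2}[z]subr0 -split_psum// F0.
split=> //.
have := derive_psum_factor (bounded_signs s') cb z1
  (is_derive_psum (bounded_signs s) z1) split_psum.
rewrite F1 subr0 => /esym/eqP; rewrite addr_eq0 => /eqP ->; rewrite Fz.
(* For n = 0 the exponent [n.-1] is a default value, but its factor [n%:R] is 0; for n > 0, z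
   z^(n-1) = z^n. *)
case: n {ss' c cb split_psum Fz} (c : nat -> Cplx R) => [|n] c /=.
  by rewrite !expr0 expr1 !mul0r !mul1r; ring.
by rewrite !exprS; ring.
Qed.

(** The leading term has modulus 2, and the gap of l zeros pushes the rest down to 2 / (1 - r) *
    r^(l+1) <= 1. This gives the lower bound on |U| in [perturb_near]. *)
Lemma modulus_psum_gap c l (r : R) z : bounded_by 2 c -> modulus (c 0%N) = 2 ->
  (forall k, (0 < k <= l)%N -> c k = 0) -> r < 1 -> modulus z <= r ->
  2 / (1 - r) * r ^+ l.+1 <= 1 -> 1 <= modulus (psum c z).
Proof.
move=> cb c0 cl r1 zr rl; have z1 := le_lt_trans zr r1.
have r0 : 0 <= r := le_trans (modulus_ge0 _) zr.
have sb : bounded_by 2 (fun k => c k.+1) by move=> k; exact: cb.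
rewrite (psum_recl cb z1) (psum_shift (n := l) sb z1); last first.
  by move=> k kl; rewrite cl.
rewrite mulrA -exprS; set t := z ^+ _ * _.
have t1 : modulus t <= 1.
  apply: le_trans rl; rewrite modulusM modulusX mulrC.
  apply: ler_pM; rewrite ?modulus_ge0 ?exprn_ge0 ?modulus_ge0//; last first.
    by rewrite lerXn2r// nnegrE ?modulus_ge0.
  have tb : bounded_by 2 (fun k => c (l + k).+1) by move=> k; exact: cb.
  apply: le_trans (modulus_psum tb z1) _.
  by rewrite ler_wpM2l// lef_pV2 ?posrE ?subr_gt0// lerB.
by have := modulusB_ge (c 0%N) (- t); rewrite opprK modulusN c0; lra.
Qed.

(* Near a zero w of order m, F' / F ~ m / (z - w). Against F' / F ~ n / z this
   puts z at distance at least of order 1/n from w, while |F(z)| <= M r^n puts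
   it at distance at most of order r^(n/m). *)
Lemma perturb_near s w (r M : R) : r < 1 -> 0 <= M -> modulus w <= r ->
  exists2 d : R, 0 < d & \forall n \near \oo, forall z (U V : Cplx R),
    modulus (w - z) < d -> modulus z <= r -> 2^-1 <= modulus z ->
    psum (signs s) z = - (z ^+ n * U) ->
    z * psum (divdiff z (signs s)) z = n%:R * psum (signs s) z - z ^+ n.+1 * V ->
    1 <= modulus U <= M -> modulus V <= M -> False.
Proof.
move=> r1 M0 wr; have w1 := le_lt_trans wr r1.
have r0 : 0 <= r := le_trans (modulus_ge0 _) wr.
have [m [b [B [bB bw Fb]]]] := zero_order (bounded_signs s) (signs_neq0 s 0) w1.
have [d d0 dG] := psum_neq0_near bB w1 bw.
set c := modulus (psum b w) / 2 in dG.
have c0 : 0 < c by rewrite divr_gt0// modulus_gt0.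
have B0 := bounded_by_ge0 bB.
pose K := B / (1 - r) / (1 - r) + B / (1 - r) + 1.
have K1 : 0 <= B / (1 - r) by rewrite divr_ge0// subr_ge0 ltW.
have K2 : 0 <= B / (1 - r) / (1 - r) by rewrite divr_ge0// subr_ge0 ltW.
have K0 : 0 < K by rewrite /K; lra.
(* On |z| <= r, K bounds both b and b'. The first radius keeps |b| >= c; the second makes |z - w|
   |b'(z)| at most c / 2, so that m b(z) dominates in F' when m > 0. *)
exists (Num.min d (c / (2 * K))); first by rewrite lt_min d0 divr_gt0// mulr_gt0.
have MM : 0 < M + 1 by lra.
have M1 := ltW MM.
have cK : 0 < c / (4 * K) by rewrite divr_gt0// mulr_gt0.
(* The threshold is the one contradicted at the end, by c (c / 4K)^m <= (n + M + 1)^m (M + 1)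
   r^n. *)
have e0 : 0 < c * (c / (4 * K)) ^+ m / (M + 1).
  by rewrite divr_gt0// mulr_gt0// exprn_gt0.
have r01 : 0 <= r < 1 by rewrite r0.
apply: filterS (poly_geometric_cvg0 m r01 M1 e0) => n nsmall z U V.
rewrite lt_min => /andP[zd zK] zr z2 FU FV /andP[U1 UM] VM.
have z1 := le_lt_trans zr r1.
set h := modulus (z - w); set f := modulus (psum (signs s) z).
have hE : modulus (w - z) = h by rewrite modulus_distC.
rewrite hE in zK.
have z0 : 0 < modulus z by lra.
set G := modulus (psum b z).
have Gc : c <= G by apply: dG.
have GK : G <= K.
  apply: le_trans (modulus_psum bB z1) _.
  apply: (@le_trans _ _ (B / (1 - r))); last by rewrite /K; lra.
  by rewrite ler_wpM2l// lef_pV2 ?posrE ?subr_gt0// lerB.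
set G' := modulus (psum (divdiff z b) z).
have GK' : G' <= K.
  apply: le_trans (modulus_psum (bounded_divdiff bB z1) z1) _.
  apply: (@le_trans _ _ (B / (1 - r) / (1 - r))); last by rewrite /K; lra.
  have i1 : (1 - modulus z)^-1 <= (1 - r)^-1.
    by rewrite lef_pV2 ?posrE ?subr_gt0// lerB.
  have i0 : 0 <= (1 - modulus z)^-1 by rewrite invr_ge0 subr_ge0 ltW.
  by rewrite !ler_pM ?mulr_ge0// ler_wpM2l.
have fE : f = h ^+ m * G by rewrite /f Fb// modulusM modulusX.
have fU : f = modulus z ^+ n * modulus U.
  by rewrite /f FU modulusN modulusM modulusX.
(* As |U| >= 1, the error term in z F'(z) is controlled by |F(z)| itself. *)
have zf : modulus z ^+ n <= f by rewrite fU ler_peMr// exprn_ge0// modulus_ge0.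
have f0 : 0 < f by apply: lt_le_trans zf; rewrite exprn_gt0.
have fr : f <= (M + 1) * r ^+ n.
  rewrite fU mulrC ler_pM ?modulus_ge0 ?exprn_ge0 ?modulus_ge0//; first by lra.
  by rewrite lerXn2r// nnegrE modulus_ge0.
have h0 : 0 <= h := modulus_ge0 _.
have chf : c * h ^+ m <= f by rewrite fE mulrC ler_wpM2l// exprn_ge0.
have nM0 : 0 < n%:R + (M + 1) by have : 0 <= n%:R :> R := ler0n _ _; lra.
(* |z - w| is at least of order 1/n, unless m = 0 *)
have hlow : (c / (4 * K)) ^+ m <= (h * (n%:R + (M + 1))) ^+ m.
  (* After the case split the order is [m.+1]. The bounds |F'| <= 2 (n + M + 1) |F| and |F'| >= |z -
     w|^m c / 2 are compared, using |F| = |z - w|^(m+1) |b|. *)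
  case: m Fb {e0 nsmall} fE chf => [|m] Fb fE chf; first by rewrite !expr0.
  apply: lerXn2r; rewrite ?nnegrE ?(ltW cK) ?mulr_ge0 ?(ltW nM0)//.
  have hpos : 0 < h ^+ m.
    rewrite exprn_gt0// lt_def h0 andbT; apply/eqP => hz.
    by move: f0; rewrite fE hz expr0n mul0r ltxx.
  set F' := modulus (psum (divdiff z (signs s)) z).
  have up : 2^-1 * F' <= (n%:R + (M + 1)) * f.
    apply: (@le_trans _ _ (modulus z * F')).
      by rewrite ler_wpM2r// modulus_ge0.
    rewrite -modulusM FV; apply: le_trans (modulusB _ _) _.
    rewrite !modulusM modulus_nat modulusX -/f mulrDl lerD2l mulrC.
    apply: ler_pM; rewrite ?modulus_ge0 ?exprn_ge0 ?modulus_ge0//; first by lra.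
    apply: le_trans zf; rewrite exprS ler_piMl ?exprn_ge0 ?modulus_ge0//.
    exact: ltW.
  have low : h ^+ m * (c / 2) <= F'.
    have fb y : modulus y < 1 ->
        psum (signs s) y = cst 0 y + (y - w) ^+ m.+1 * psum b y.
      by move=> y1; rewrite Fb// add0r.
    rewrite /F' (derive_psum_factor (bounded_signs s) bB z1
      (is_derive_cst 0 z 1) fb) add0r /= exprSr.
    rewrite (_ : _ + _ = (z - w) ^+ m * (m.+1%:R * psum b z +
       (z - w) * psum (divdiff z b) z)); last by ring.
    rewrite modulusM modulusX -/h ler_wpM2l ?(ltW hpos)//.
    have := modulusB_ge (m.+1%:R * psum b z) (- ((z - w) * psum (divdiff z b) z)).
    rewrite opprK modulusN !modulusM modulus_nat -/h -/G -/G'; apply: le_trans.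
    have G0 : 0 <= G := modulus_ge0 _.
    have p1 : G <= m.+1%:R * G by rewrite ler_peMl// ler1n.
    have p2 : h * G' <= h * K by rewrite ler_wpM2l.
    have p3 : h * K <= c / 2.
      have := ltW zK; rewrite ler_pdivlMr ?mulr_gt0//; lra.
    by lra.
  have : h ^+ m * (c / 2) <= 2 * ((n%:R + (M + 1)) * f).
    by apply: le_trans low _; lra.
  rewrite fE exprSr => hh.
  have {}hh : h ^+ m * (c / 2) <= h ^+ m * (2 * ((n%:R + (M + 1)) * (h * G))).
    by apply: le_trans hh _; rewrite le_eqVlt; apply/orP; left; apply/eqP; ring.
  rewrite ler_pM2l// in hh.
  rewrite ler_pdivrMr ?mulr_gt0//.
  have p : (n%:R + (M + 1)) * (h * G) <= (n%:R + (M + 1)) * (h * K).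
    by rewrite !ler_wpM2l// ltW.
  have -> : h * (n%:R + (M + 1)) * (4 * K) = 4 * ((n%:R + (M + 1)) * (h * K)).
    by ring.
  by lra.
have : c * (c / (4 * K)) ^+ m < c * (c / (4 * K)) ^+ m; last by rewrite ltxx.
rewrite ltr_pdivlMr// in nsmall; apply: le_lt_trans nsmall.
apply: (@le_trans _ _ (c * (h * (n%:R + (M + 1))) ^+ m)).
  by rewrite ler_wpM2l// ltW.
have N0 : 0 <= (n%:R + (M + 1)) ^+ m by rewrite exprn_ge0// ltW.
have := ler_wpM2l N0 (le_trans chf fr); rewrite exprMn.
by congr (_ <= _); ring.
Qed.

(** [perturb_near] gives each w of the closed disc a neighbourhood and a threshold for n;
    compactness makes the threshold uniform. The window length l depends on r alone. *)
Lemma double_zero_flip (r : R) : 0 <= r < 1 -> exists l : nat, forall s,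
  \forall n \near \oo, forall s' z, modulus z <= r -> double_zero s' z ->
    (forall k, (k < n)%N -> s' k = s k) -> s' n <> s n ->
    (forall k, (n < k <= n + l)%N -> s' k = s k) -> False.
Proof.
move=> /andP[r0 r1].
(* The coefficients of U are differences of two signs, hence of modulus at most 2; M bounds both U
   and U' on |z| <= r. *)
pose M := 2 / (1 - r) / (1 - r) + 2 / (1 - r).
have M0 : 0 <= M by rewrite addr_ge0// !mulr_ge0// invr_ge0 subr_ge0 ltW.
have [l rl] : exists l, 2 / (1 - r) * r ^+ l.+1 <= 1.
  have r1' : `|r| < 1 by rewrite ger0_norm.
  have /cvgrPdist_lt/(_ 1 ltr01) [l _ /(_ l.+1)] :=
    cvg_geometric (2 / (1 - r)) r1'.
  rewrite /= leqnSn sub0r normrN => /(_ isT) h; exists l.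
  exact: ltW (le_lt_trans (ler_norm _) h).
exists l => s.
have /compact_near_coveringP/near_covering_withinP cover :=
  @compact_closed_disc R r.
suff : \forall n \near \oo, [set z | modulus z <= r] `<=` (fun z => forall s',
    double_zero s' z ->
    (forall k, (k < n)%N -> s' k = s k) -> s' n <> s n ->
    (forall k, (n < k <= n + l)%N -> s' k = s k) -> False).
  by apply: filterS => n h s' z zr; exact: h.
apply: cover => w wr.
have [d d0 dn] := perturb_near s r1 M0 wr.
exists ([set z | modulus (w - z) < d],
        [set n | forall z (U V : Cplx R), modulus (w - z) < d ->
    modulus z <= r -> 2^-1 <= modulus z ->
    psum (signs s) z = - (z ^+ n * U) ->
    z * psum (divdiff z (signs s)) z = n%:R * psum (signs s) z - z ^+ n.+1 * V ->
    1 <= modulus U <= M -> modulus V <= M -> False]).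
  by split=> //; apply/nbhs_CplxP; exists d.
move=> [z n] /= [zd hn] zr s' dz ss' sn sl.
have z1 := le_lt_trans zr r1.
have [FU FV] := double_zero_perturb z1 ss' dz.
set c := (fun k => _) in FU FV.
have cb : bounded_by 2 c.
  move=> k; apply: le_trans (modulusB _ _) _; rewrite !modulus_signs; lra.
have c0 : modulus (c 0%N) = 2.
  rewrite /c addn0 -rmorphB/= modulus_real /rademacher.
  case: (s' n) (s n) sn => -[]// _; last by rewrite -normrN opprB opprK ger0_norm.
  by rewrite opprK ger0_norm.
have cl k : (0 < k <= l)%N -> c k = 0.
  move=> /andP[k0 kl]; rewrite /c /signs /rademacher sl ?subrr//.
  by rewrite -[X in (X < _)%N]addn0 ltn_add2l k0 leq_add2l.
have i1 : (1 - modulus z)^-1 <= (1 - r)^-1.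
  by rewrite lef_pV2 ?posrE ?subr_gt0// lerB.
have i0 : 0 <= (1 - modulus z)^-1 by rewrite invr_ge0 subr_ge0 ltW.
have j0 : 0 <= 2 / (1 - r) by rewrite divr_ge0// subr_ge0 ltW.
have j1 : 0 <= 2 / (1 - r) / (1 - r) by rewrite divr_ge0// subr_ge0 ltW.
have q1 : 2 / (1 - modulus z) <= 2 / (1 - r) by rewrite ler_wpM2l.
apply: (hn z (psum c z) (psum (divdiff z c) z) zd zr) => //.
- exact: zero_modulus_ge_half dz.1.
- rewrite (modulus_psum_gap cb c0 cl r1 zr rl)/=.
  apply: le_trans (modulus_psum cb z1) _; apply: le_trans q1 _.
  by rewrite lerDr.
- apply: le_trans (modulus_psum (bounded_divdiff cb z1) z1) _.
  apply: (@le_trans _ _ (2 / (1 - r) / (1 - r))); last by rewrite lerDl.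
  by rewrite ler_pM// mulr_ge0.
Qed.

End Flip.

(** * Null events for fair signs *)

Section FairBits.
Context {d : measure_display} {T : measurableType d} {R : realType}.
Variables (P : probability T R) (X : T -> nat -> bool).

Definition initial p (s : nat -> bool) : {ffun 'I_p -> bool} :=
  [ffun i : 'I_p => s i].

Lemma initialP p s s' :
  initial p s = initial p s' <-> forall k, (k < p)%N -> s k = s' k.
Proof.
split=> [/ffunP e k kp|e]; first by have := e (Ordinal kp); rewrite !ffunE.
by apply/ffunP => i; rewrite !ffunE e.
Qed.

Hypothesis fair : forall p f, measurable [set w | initial p (X w) = f] /\
  P [set w | initial p (X w) = f] = (2^-1 ^+ p)%:E.

Definition initial_in p (l : seq {ffun 'I_p -> bool}) : set T :=
  [set w | initial p (X w) \in l].

Lemma initial_in_cons p f (l : seq {ffun 'I_p -> bool}) :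
  initial_in (f :: l) = [set w | initial p (X w) = f] `|` initial_in l.
Proof.
apply/seteqP; split=> w /=; rewrite /initial_in/= inE.
  by case/orP => [/eqP|]; [left|right].
by case=> [->|->]; rewrite ?eqxx ?orbT.
Qed.

Lemma measurable_initial_in p (l : seq {ffun 'I_p -> bool}) :
  measurable (initial_in l).
Proof.
elim: l => [|f l IH]; first by rewrite (_ : initial_in _ = set0)// -subset0.
by rewrite initial_in_cons; apply: measurableU => //; exact: (fair _).1.
Qed.

Lemma prob_initial_in p (l : seq {ffun 'I_p -> bool}) : uniq l ->
  P (initial_in l) = ((size l)%:R * 2^-1 ^+ p)%:E.
Proof.
elim: l => [_|f l IH /= /andP[fl ul]].
  by rewrite (_ : initial_in _ = set0) ?measure0 ?mul0r// -subset0.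
have [mf Pf] := fair f; have ml := measurable_initial_in l.
rewrite initial_in_cons measureU//.
  rewrite -nat1r mulrDl mul1r EFinD.
  by congr (_ + _)%E; [exact: Pf|exact: IH].
by rewrite -subset0 => w [/= wf]; rewrite /initial_in/= wf (negPf fl).
Qed.

Definition flip_at p (n : nat) (f : {ffun 'I_p -> bool}) : {ffun 'I_p -> bool} :=
  [ffun i => if val i == n then ~~ f i else f i].

Lemma flip_atK p n : involutive (@flip_at p n).
Proof.
by move=> f; apply/ffunP => i; rewrite !ffunE; case: eqP; rewrite ?negbK.
Qed.

(* As E is approximated by the initial-segment events A_p, of probability q_p,
   a flip of bit n keeps a point of A_p in A_p with probability at
   least 2 q_p - q_n, p = n + l + 1; by hypothesis this happens for finitely
   many n only, so that 2 q - q <= 0 in the limit. *)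
Lemma negligible_of_flip (E : (nat -> bool) -> Prop) (l : nat) :
  (forall s, \forall n \near \oo, forall s', E s' ->
    (forall k, (k < n)%N -> s' k = s k) -> s' n <> s n ->
    (forall k, (n < k <= n + l)%N -> s' k = s k) -> False) ->
  P.-negligible [set w | E (X w)].
Proof.
move=> Eflip.
(* [S p] lists the patterns of length p that extend to an element of E; [A p] below is the matching
   cylinder event. *)
pose S p := enum [pred f : {ffun 'I_p -> bool} |
  `[< exists2 s, E s & initial p s = f >]].
have SP p f : f \in S p <-> exists2 s, E s & initial p s = f.
  by rewrite mem_enum inE.
pose A p := initial_in (S p).
have mA p : measurable (A p) by exact: measurable_initial_in.
have AE p w : A p w <-> exists2 s, E s & forall k, (k < p)%N -> s k = X w k.
  rewrite /A /initial_in/= SP.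
  by split=> -[s Es es]; exists s => //; apply/initialP.
have Adecr : nonincreasing_seq A.
  move=> p q pq; apply/subsetPset => w /AE[s Es es]; apply/AE.
  by exists s => // k kp; apply: es; exact: leq_trans pq.
(* This intersection is the measurable cover required of a negligible set. *)
have mN : measurable (\bigcap_p A p) by exact: bigcapT_measurable.
exists (\bigcap_p A p); split=> //; last first.
  by move=> w Ew p _; apply/AE; exists (X w).
(* [A' n] holds when flipping bit n leads into [A (n + l).+1]; flipping permutes the patterns, so
   the two events are equally likely. Length n + l + 1 makes the whole window n + 1, ..., n + l
   visible. *)
pose A' n := initial_in (map (flip_at n) (S (n + l).+1)).
have mA' n : measurable (A' n) by exact: measurable_initial_in.
pose B n := A (n + l).+1 `&` A' n.
have mB n : measurable (B n) by exact: measurableI.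
have PA' n : P (A' n) = P (A (n + l).+1).
  rewrite !prob_initial_in ?size_map ?enum_uniq//.
  by rewrite map_inj_uniq ?enum_uniq//; exact: inv_inj (@flip_atK _ _).
have A'E n w : A' n w -> exists s, [/\ E s, (forall k, (k < n)%N -> s k = X w k),
    s n <> X w n & (forall k, (n < k <= n + l)%N -> s k = X w k)].
  move=> /mapP[f /SP[s Es <-]] e; exists s; split=> // [k kn||k /andP[nk kl]].
  - have kp : (k < (n + l).+1)%N by lia.
    have /ffunP/(_ (Ordinal kp)) := e; rewrite !ffunE/= => ->.
    by rewrite ltn_eqF.
  - have kp : (n < (n + l).+1)%N by lia.
    have /ffunP/(_ (Ordinal kp)) := e; rewrite !ffunE/= eqxx => ->.
    by case: (s n).
  - have kp : (k < (n + l).+1)%N by lia.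
    have /ffunP/(_ (Ordinal kp)) := e; rewrite !ffunE/= => ->.
    by rewrite gtn_eqF.
(* By [Eflip] each outcome lies in only finitely many [B n], so these tail unions decrease to the
   empty set. *)
pose C N := \bigcup_(n in [set n | (N <= n)%N]) B n.
have mC N : measurable (C N) by apply: bigcup_measurable => n _; exact: mB.
have C0 : \bigcap_N C N = set0.
  rewrite -subset0 => w Cw.
  have [N _ EN] := Eflip (X w).
  have [n Nn [_ /A'E[s [Es s1 s2 s3]]]] := Cw N I.
  exact: EN Nn _ Es s1 s2 s3.
have Cdecr : nonincreasing_seq C.
  by move=> p q pq; apply/subsetPset; apply: bigcup_subset => n /=; exact: leq_trans.
have leN n : (P (\bigcap_p A p) <= P (A n))%E.
  by apply: le_measure; rewrite ?inE// => w; apply.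
(* Inclusion-exclusion: [A (n + l).+1] and [A' n] each have at least the probability of the limit
   set, and their union lies in [A n] because a flip at n leaves the first n bits alone. *)
have main n : (P (\bigcap_p A p) + P (\bigcap_p A p) <= P (A n) + P (C n))%E.
  apply: (@le_trans _ _ (P (A (n + l).+1 `|` A' n) + P (B n))%E); last first.
    apply: leeD; apply: le_measure; rewrite ?inE//; first exact: measurableU.
      move=> w [/AE[s Es es]|/A'E[s [Es es _ _]]]; apply/AE; exists s => // k kn.
      by apply: es; lia.
    by apply: bigcup_sup => /=.
  rewrite measureUfinr//; last by rewrite ltey_eq fin_num_measure.
  rewrite subeK ?fin_num_measure//; last exact: measurableI.
  by apply: leeD; [exact: leN|have := leN (n + l).+1; rewrite -PA'; apply].
have PAfin : (P (A 0%N) < +oo)%E by rewrite ltey_eq fin_num_measure.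
have PCfin : (P (C 0%N) < +oo)%E by rewrite ltey_eq fin_num_measure.
have cA := nonincreasing_cvg_mu PAfin mA mN Adecr.
have mC0 : measurable (\bigcap_N C N) by rewrite C0.
have := nonincreasing_cvg_mu PCfin mC mC0 Cdecr.
rewrite C0 measure0 => cC.
have finN : P (\bigcap_p A p) \is a fin_num by rewrite fin_num_measure.
have cAC : (P (A n) + P (C n) @[n --> \oo] --> P (\bigcap_p A p))%E.
  by rewrite -[P (\bigcap_p _)]adde0; apply: cvgeD => //; rewrite fin_num_adde_defl.
have : (P (\bigcap_p A p) + P (\bigcap_p A p) <= P (\bigcap_p A p))%E.
  rewrite -(cvg_lim _ cAC)//; apply: lime_ge; first by apply: cvgP cAC.
  by apply: nearW => n; rewrite (cvg_lim _ cAC).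
rewrite -[leRHS]adde0 leeD2lE// => le0; apply/eqP.
by rewrite eq_le le0/= measure_ge0.
Qed.

End FairBits.

(** * Simple zeros and [kappa_good] on compact sets *)

Section GoodSets.
Context {R : realType}.
Implicit Types (z w : Cplx R) (s : nat -> bool).

(** Near w with F(w) nonzero there are no zeros. Near a simple zero w the quotient F(z) / (z - w)
    does not vanish, so w is the only zero and every kappa < |F'(w)| works. Compactness makes the
    choice of kappa uniform. *)
Lemma good_on_compact s (K : set (Cplx R)) : compact K ->
  K `<=` [set z | modulus z < 1] ->
  (forall z, modulus z < 1 -> ~ double_zero s z) ->
  \forall kappa \near (0 : R)^'+, forall z, K z -> psum (signs s) z = 0 ->
    kappa <= modulus (psum (divdiff z (signs s)) z).
Proof.
move=> /compact_near_coveringP/near_covering_withinP cover K1 simple.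
apply: cover => w Kw; have w1 := K1 _ Kw.
have sb := @bounded_signs R s.
have [Fw|/eqP Fw] := pselect (psum (signs s) w = 0); last first.
  have [d d0 Fz] := psum_neq0_near sb w1 Fw.
  exists ([set z | modulus (w - z) < d], setT).
    by split=> /=; [apply/nbhs_CplxP; exists d|exact: filterT].
  move=> [z k] /= [zd _] _ F0; have := Fz z zd; rewrite F0 modulus0.
  by move: Fw; rewrite -modulus_gt0 => Fw; lra.
have Gw : psum (divdiff w (signs s)) w != 0.
  by apply/eqP => Gw; apply: (simple _ w1).
have [d d0 Gz] := psum_neq0_near (bounded_divdiff sb w1) w1 Gw.
have G0 : 0 < modulus (psum (divdiff w (signs s)) w) by rewrite modulus_gt0.
exists ([set z | modulus (w - z) < d],
        [set k | k < modulus (psum (divdiff w (signs s)) w)]).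
  by split=> /=; [apply/nbhs_CplxP; exists d|exact: nbhs_right_lt].
move=> [z k] /= [zd kG] Kz F0.
have : psum (signs s) z = 0 := F0.
rewrite (psum_divdiff sb w1 (K1 _ Kz)) Fw add0r => /eqP; rewrite mulf_eq0.
case/orP => [|/eqP Gz0].
  by rewrite subr_eq0 => /eqP ->; exact: ltW.
by have := Gz z zd; rewrite Gz0 modulus0; lra.
Qed.

Lemma power_seriesE (a : nat -> R) z :
  power_series a z = psum (fun k => (a k)%:C%C) z.
Proof. by rewrite psum.unlock. Qed.

Lemma rademacherE (a : nat -> R) : littlewood a ->
  a = rademacher (fun k => a k == 1).
Proof.
move=> la; apply/funext => k; rewrite /rademacher.
by case: (la k) => ->; rewrite ?eqxx// eqNr oner_eq0.
Qed.

Lemma derive_power_series s z : modulus z < 1 ->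
  (power_series (rademacher s : nat -> R))^`()%classic z =
  psum (divdiff z (signs s)) z.
Proof.
move=> z1; rewrite derive1E.
have -> : power_series (rademacher s : nat -> R) = psum (signs s).
  by apply/funext => y; exact: power_seriesE.
exact: (@derive_val _ _ _ _ _ _ _ (is_derive_psum (bounded_signs s) z1)).
Qed.

Lemma unit_discE z : unit_disc z = (modulus z < 1).
Proof. by rewrite /unit_disc/= -lt_modulus. Qed.

End GoodSets.

(** * Random signs and the almost sure statements *)

Section RandomSigns.
Context {d : measure_display} {T : measurableType d} {R : realType}.
Variables (P : probability T R) (eps : nat -> {RV P >-> R}).

(** Every value other than 1 is read as the sign -1, which agrees with [eps] off the null event of
    [ae_littlewood]. *)
Definition bits (w : T) (k : nat) : bool := eps k w == 1.

Lemma measurable_eps k (B : set R) : measurable B -> measurable (eps k @^-1` B).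
Proof. by move=> mB; rewrite -[X in measurable X]setTI; exact: measurable_funP. Qed.

Hypothesis eps_pos : forall k, P [set w | eps k w = 1] = (2^-1)%:E.

Lemma bits_fair (eps_indep : mutually_independent eps) p f :
  measurable [set w | initial p (bits w) = f] /\
  P [set w | initial p (bits w) = f] = (2^-1 ^+ p)%:E.
Proof.
(* [insub] turns k < p into an index of f; [setT] is the default for larger k. *)
pose B k : set R := if insub k is Some i then
  (if f i then [set 1] else ~` [set 1]) else setT.
have mB k : measurable (B k).
  by rewrite /B; case: insub => // i; case: (f i) => //; exact: measurableC.
pose J := seq_fset tt (iota 0 p).
have JE k : (k \in J) = (k < p)%N by rewrite seq_fsetE mem_iota add0n.
have -> : [set w | initial p (bits w) = f] =
    \bigcap_(k in [set` J]) (eps k @^-1` B k).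
  apply/seteqP; split=> w /=.
    move=> wf k /=; rewrite JE => kp.
    rewrite /B insubT -wf ffunE /bits/=.
    by case: eqP.
  move=> wB; apply/ffunP => i; rewrite ffunE /bits.
  have := wB (val i); rewrite /= JE => /(_ (ltn_ord i)).
  by rewrite /B/= valK; case: (f i) => /eqP// /negPf.
split.
  by apply: fin_bigcap_measurable => // k _; exact: measurable_eps.
rewrite eps_indep// big_seq (eq_bigr (fun=> (2^-1)%:E)).
  rewrite -big_seq prodEFin big_const_seq count_predT.
  by rewrite size_seq_fset undup_id ?iota_uniq// size_iota iter_mulr_1.
move=> k; rewrite JE => kp.
rewrite /B insubT; case: (f _); first exact: eps_pos.
rewrite -preimage_setC probability_setC; last exact: measurable_eps.
have := eps_pos k; rewrite /preimage/= => ->.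
by rewrite -EFinB; congr EFin; lra.
Qed.

Hypothesis eps_neg : forall k, P [set w | eps k w = -1] = (2^-1)%:E.

Lemma ae_littlewood : {ae P, forall w, littlewood (fun k => eps k w)}.
Proof.
apply: ae_foralln => k.
have m1 : measurable [set w | eps k w = 1] by exact: measurable_eps [set 1] _.
have mN1 : measurable [set w | eps k w = -1] by exact: measurable_eps [set -1] _.
have disj : [set w | eps k w = 1] `&` [set w | eps k w = -1] = set0.
  by rewrite -subset0 => w /= [->] /eqP; rewrite eq_sym eqNr oner_eq0.
have PU : P ([set w | eps k w = 1] `|` [set w | eps k w = -1]) = 1%E.
  rewrite measureU// [X in (X + _)%E]eps_pos [X in (_ + X)%E]eps_neg -EFinD.
  by congr EFin; lra.
exists (~` ([set w | eps k w = 1] `|` [set w | eps k w = -1])); split=> //.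
  by apply: measurableC; exact: measurableU.
by apply: etrans (probability_setC P (measurableU _ _ m1 mN1)) _; rewrite PU subee.
Qed.

End RandomSigns.

Lemma ae_simple_zeros (d : measure_display) (T : measurableType d) (R : realType)
    (P : probability T R) (eps : nat -> {RV P >-> R})
    (eps_indep : mutually_independent eps)
    (eps_pos : forall k, P [set w | eps k w = 1] = (2^-1)%:E) :
  {ae P, forall w, forall z : Cplx R, modulus z < 1 ->
     ~ double_zero (bits eps w) z}.
Proof.
(* Closed discs of these radii exhaust the unit disc, leaving a countable union of null events. *)
pose r n : R := 1 - n.+1%:R^-1.
have r01 n : 0 <= r n < 1.
  by rewrite /r subr_ge0 invf_le1 ?ltr0n// ler1n/= gtrBl invr_gt0 ltr0n.
have neg n : P.-negligible [set w | exists2 z : Cplx R, modulus z <= r n &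
    double_zero (bits eps w) z].
  have [l flip] := double_zero_flip (r01 n).
  apply: (negligible_of_flip (fun p f => bits_fair eps_pos eps_indep f)
    (E := fun s => exists2 z : Cplx R, modulus z <= r n & double_zero s z)
    (l := l)).
  by move=> s; apply: filterS (flip s) => m h s' [z zr dz]; exact: h zr dz.
apply: negligibleS (negligible_bigcup neg) => w /= /existsNP[z].
move=> /not_implyP[z1 /contrapT dz].
have z1' : 0 < 1 - modulus z by rewrite subr_gt0.
(* This n satisfies n + 1 > 1 / (1 - |z|), that is, |z| < r n. *)
exists (Num.truncn (1 - modulus z)^-1) => //; exists z => //.
rewrite /r lerBrDr -lerBrDl -[leRHS]invrK lef_pV2 ?posrE ?ltr0n ?invr_gt0//.
by rewrite ltW// truncnS_gt.
Qed.

Theorem theorem2 (d : measure_display) (T : measurableType d) (R : realType)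
    (P : probability T R) (eps : nat -> {RV P >-> R})
    (eps_indep : mutually_independent eps)
    (eps_pos : forall k, P [set w | eps k w = 1] = (2^-1)%:E)
    (eps_neg : forall k, P [set w | eps k w = -1] = (2^-1)%:E) :
  let F (w : T) := power_series (fun k => eps k w) in
  {ae P, forall w, ~ exists z : Cplx R,
     [/\ unit_disc z, F w z = 0 & (F w)^`()%classic z = 0]} /\
  {ae P, forall w, forall K : set (Cplx R),
     compact K -> K `<=` @unit_disc R ->
     \forall kappa \near 0^'+, kappa_good kappa K (fun k => eps k w)}.
Proof.
move=> F.
have lw := ae_littlewood eps_pos eps_neg.
have sw := ae_simple_zeros eps_indep eps_pos.
split.
  apply: filterS2 lw sw => w lw sw [z [z1 Fz F'z]].
  rewrite unit_discE in z1; apply: (sw z z1).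
  rewrite /F (rademacherE lw) in Fz F'z.
  by split; [rewrite -Fz power_seriesE|rewrite -F'z derive_power_series].
apply: filterS2 lw sw => w lw sw K cK K1.
have K1' : K `<=` [set z | modulus z < 1] by move=> z /K1; rewrite unit_discE.
apply: filterS (good_on_compact cK K1' sw) => k hk; split=> // z Kz Fz.
rewrite (rademacherE lw) in Fz *.
rewrite derive_power_series; last exact: K1'.
by rewrite normE lecR; apply: hk => //; rewrite -Fz power_seriesE.
Qed.
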